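(* Let $T>t_N$. Consider the data-driven differential inclusion $$\dot x(t)\in co\{\dot X_-(t),\dot X_+(t)\},\qquad x(t_N)=x_N,\qquad \dot X_\pm(t)=f(t)+g(t)u\pm M\sigma(t),$$ and the semi-algebraic unsafe set $$\mathcal{X}_u=\{x\in\mathbb{R}^n\mid l_i(x)\le0,\ i=1,\dots,n_c\},\qquad l_i\in\mathcal{R}[x].$$ Suppose there exist $B\in\mathcal{R}[x,t]$, $W\in\Sigma[x,t]$, $m_1,m_2\in\Sigma[x,t]$, $s_i\in\Sigma[x]$ ($i=1,\dots,n_c$), $q_1\in\mathcal{R}[x,t]^m$, $q_2\in\Sigma[x,t]$ and a constant $c>0$ such that $$B(x,T)-B(x_N,t_N)+\sum_{i=1}^{n_c}s_i(x)\,l_i(x)-c\in\Sigma[x],$$ $$-\frac{\partial B}{\partial t}-\Big(\frac{\partial B}{\partial x}\Big)^T(f-M\sigma)-W(x,t)-m_1(x,t)(t-t_N)(T-t)\in\Sigma[x,t],$$ $$-\frac{\partial B}{\partial t}-\Big(\frac{\partial B}{\partial x}\Big)^T(f+M\sigma)-W(x,t)-m_2(x,t)(t-t_N)(T-t)\in\Sigma[x,t],$$ $$-\Big(\Big(\frac{\partial B}{\partial x}\Big)^Tg\Big)q_1-q_2\in\Sigma[x,t].$$ Then, under the controller $$u=g^T\frac{\partial B}{\partial x}\left(\Big(\frac{\partial B}{\partial x}\Big)^Tgg^T\frac{\partial B}{\partial x}\right)^{-1}W(x,t),$$ every solution $x(\cdot)$ of the differential inclusion satisfies $x(T)\notin\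mathcal{X}_u$.
   Context: $co$ denotes the convex hull. $\mathcal{R}[x]$, $\mathcal{R}[x,t]$ are the real polynomials in the indicated variables ($x\in\mathbb{R}^n$, $t\in\mathbb{R}$). $\Sigma[\cdot]\subset\mathcal{R}[\cdot]$ is the subset of sums of squares of polynomials. Samples of state and input are available at times $t_1\le\cdots\le t_N$, and $x_N\in\mathbb{R}^n$ is the state at time $t_N$. A spline fit of the data gives the control-affine model $\dot X(t)=f(t)+g(t)u$, $u\in\mathbb{R}^m$, with $f(t)\in\mathbb{R}^n$, $g(t)\in\mathbb{R}^{n\times m}$ having (piecewise) polynomial entries in $t$. $M>0$ is a constant and $\sigma:\mathbb{R}_{\ge0}\to\mathbb{R}_{\ge0}$ satisfies $|\dot X(t)-\dot x(t)|\le M\sigma(t)$ (side information). In $f\pm M\sigma$ and $f+gu\pm M\sigma$ the scalar $M\sigma(t)$ is added to (subtracted from) every component. $\partial B/\partial x$ is the gradient in $x$ (a column vector). Standing assumption: $\sigma\in\Sigma[t]$ and on $[t_N,T]$ the entries of $f$ and $g$ are polynomials in $t$; these polynomials are used in the sum-of-squares conditions. A solution on $[t_N,T]$ under the controller is an absolutely continuous function $x(\cdot)$ with values in $\mathbb{R}^n$ and $x(t_N)=x_N$ satisfying the inclusion for almost every $t$, where $u$ is the controller formula evaluated at $(x(t),t)$ (the formula being defined there). *)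

(* Defs.v *)
(* [mpoly] is imported without its notations, which clash with those of
   MathComp-Analysis. *)
From HB Require Import structures.
From mathcomp Require Import all_boot all_order all_algebra.
From mathcomp Require Import all_classical all_reals all_analysis.
From mathcomp Require Import -(notations) mpoly.

Set Implicit Arguments.
Unset Strict Implicit.
Unset Printing Implicit Defensive.

Import Order.TTheory GRing.Theory Num.Theory.
Import numFieldNormedType.Exports.

Local Open Scope classical_set_scope.
Local Open Scope ring_scope.

Definition sos (A : pzRingType) (p : A) : Prop :=
  exists s : seq A, p = \sum_(q <- s) q ^+ 2.

Definition co (R : realType) (V : lmodType R) (A : set V) : set V :=
  smallest (@convex_set R V) A.

Definition abs_cont (R : realType) (V : normedModType R) (a b : R)
    (x : R -> V) : Prop :=
  forall e : R, 0 < e -> exists2 d : R, 0 < d &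
    forall (k : nat) (l r : 'I_k -> R),
      (forall i, [/\ a <= l i, l i <= r i & r i <= b]) ->
      trivIset [set: 'I_k] (fun i => `]l i, r i[%classic) ->
      \sum_(i < k) (r i - l i) < d ->
      \sum_(i < k) `|x (r i) - x (l i)| < e.

(* R[x] is [mpoly n R] and R[x,t] is [mpoly (n + 1) R]: the variables of index
   [lshift 1 i] are the coordinates of x, the variable of index [rshift n ord0]
   is t. *)
Section Polynomials.
Variables (R : realType) (n : nat).
Local Notation Rx := (mpoly n R).
Local Notation Rxt := (mpoly (n + 1)%N R).

Definition eval_x (p : Rx) (x : 'cV[R]_n) : R :=
  meval (fun k => x k 0) p.

Definition eval_xt (p : Rxt) (x : 'cV[R]_n) (t : R) : R :=
  meval (fun k => col_mx x t%:M k 0) p.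

Definition tvar : Rxt := mpolyX R (mnm1 (rshift n ord0)).

Definition cst_x (c : R) : Rx := mpolyC n c.

Definition cst_xt (c : R) : Rxt := mpolyC (n + 1)%N c.

(* The inclusion of R[t] in R[x,t]. *)
Definition of_t (p : {poly R}) : Rxt := (map_poly cst_xt p).[tvar].

(* The polynomial p(x,s) in R[x], for a fixed real number s. *)
Definition at_time (s : R) (p : Rxt) : Rx :=
  comp_mpoly
    [tuple match fintype.split k with
           | inl i => mpolyX R (mnm1 i)
           | inr _ => cst_x s
           end | k < (n + 1)%N] p.

Definition dt (B : Rxt) : Rxt := mderiv (rshift n ord0) B.

Definition grad (B : Rxt) : 'cV[Rxt]_n :=
  \col_i mderiv (lshift 1 i) B.

Definition grad_at (B : Rxt) (x : 'cV[R]_n) (t : R) : 'cV[R]_n :=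
  map_mx (fun p => eval_xt p x t) (grad B).

End Polynomials.

Section ClosedLoop.
Variables (R : realType) (n m : nat).
Variables (f : R -> 'cV[R]_n) (g : R -> 'M[R]_(n, m)) (M : R).
Variables (sigma : {poly R}) (B W : mpoly (n + 1)%N R).

Definition Xdot_minus (t : R) (u : 'cV[R]_m) : 'cV[R]_n :=
  f t + g t *m u - const_mx (M * sigma.[t]).

Definition Xdot_plus (t : R) (u : 'cV[R]_m) : 'cV[R]_n :=
  f t + g t *m u + const_mx (M * sigma.[t]).

Definition control_denom (x : 'cV[R]_n) (t : R) : 'M[R]_1 :=
  (grad_at B x t)^T *m g t *m (g t)^T *m grad_at B x t.

(* [invmx] is total: the formula is meaningful only where [control_denom] is
   invertible, which [is_solution] requires. *)
Definition control (x : 'cV[R]_n) (t : R) : 'cV[R]_m :=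
  (g t)^T *m grad_at B x t *m invmx (control_denom x t) *m (eval_xt W x t)%:M.

(* [x] is a total function, but only its values on [tN, T] matter: the end
   points, where the derivative would involve other values, are negligible. *)
Definition is_solution (tN T : R) (xN : 'cV[R]_n) (x : R -> 'cV[R]_n) : Prop :=
  [/\ abs_cont tN T x,
      x tN = xN &
      {ae @lebesgue_measure R, forall t : R, tN <= t <= T ->
        control_denom (x t) t \in unitmx /\
        exists2 v : 'cV[R]_n, is_derive t 1 x v &
          co [set Xdot_minus t (control (x t) t);
                  Xdot_plus t (control (x t) t)] v}].

End ClosedLoop.

Definition unsafe_set (R : realType) (n nc : nat)
    (l : 'I_nc -> mpoly n R) : set 'cV[R]_n :=
  [set x | forall i : 'I_nc, eval_x (l i) x <= 0].

(* Main.v *)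
Require Import Defs.
From HB Require Import structures.
From mathcomp Require Import all_boot all_order all_algebra.
From mathcomp Require Import all_classical all_reals all_analysis.
From mathcomp Require Import -(notations) mpoly.
From mathcomp Require Import ring lra.

Set Implicit Arguments.
Unset Strict Implicit.
Unset Printing Implicit Defensive.

Import Order.TTheory GRing.Theory Num.Theory.
Import numFieldNormedType.Exports.
Local Open Scope classical_set_scope.
Local Open Scope ring_scope.

(** B is a barrier: it does not increase along a solution, whereas an unsafe
    end point would force it to increase by at least c > 0.

    At almost every time the velocity of a solution is a convex combination
    r (f + gu - M sigma) + (1 - r) (f + gu + M sigma) ([co_pair]). The formula
    for u is the one that makes (dB/dx)^T g u equal to W
    ([grad_mul_control]), so the chain rule ([is_derive_eval_xt]) gives the
    derivative of t |-> B(x(t), t) as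
      dB/dt + (dB/dx)^T (f + (1 - 2 r) M sigma) + W.
    This is affine in r. At both extreme values of r it is at most 0 on
    [tN, T], by the two sum-of-squares conditions on f - M sigma and
    f + M sigma ([sos_decrease_condition]); hence it is at most 0 for every r.

    To integrate this inequality, t |-> B(x(t), t) is absolutely continuous,
    being a polynomial in absolutely continuous functions
    ([abs_cont_meval]), and an absolutely continuous function whose derivative
    is almost everywhere at most 0 ends no higher than it starts
    ([abs_cont_ae_derive_le0]). For the latter fact the exceptional set is put
    in an open set of small measure, and [a, b] is cut into short intervals
    that either lie in this open set, where absolute continuity bounds the sum
    of the increments, or surround a point with derivative at most 0, where the
    increments are at most e times the length. The existence of such a cutting
    is obtained by moving from a to b ([creeping_induction]).

    Finally, at an unsafe x(T) the terms s_i l_i are at most 0, so the first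
    sum-of-squares condition yields B(x(T), T) - B(xN, tN) - c >= 0
    ([sos_certificate_ge0]). *)

(** * Monotonicity of absolutely continuous functions *)

(** A real-line induction, equivalent to the existence of a tagged partition of
    [a, b] that is fine for any prescribed gauge d(t): the supremum of the
    points reached is itself reached, and passed unless it is b. *)
Lemma creeping_induction (R : realType) (a b : R) (P : R -> Prop) :
  a <= b -> P a ->
  (forall t, a <= t <= b -> exists2 d, 0 < d &
     forall s y, a <= s -> s <= t -> t <= y -> y <= b ->
       t - d < s -> y < t + d -> P s -> P y) ->
  P b.
Proof.
move=> ab Pa step.
pose S := [set t | a <= t <= b /\ P t].
have Sa : S a by split; rewrite ?lexx.
have ubS : has_ubound S by exists b => t [/andP[_ ->]].
have supS : has_sup S by split=> //; exists a.
have ac : a <= sup S by exact: ub_le_sup Sa.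
have cb : sup S <= b by apply: ge_sup; [exists a | move=> t [/andP[_ ->]]].
have [|d d0 loc] := step (sup S); first by rewrite ac cb.
have [s [/andP[as_ sb] Ps] ds] := sup_adherent d0 supS.
have sc : s <= sup S by apply: ub_le_sup => //; split=> //; rewrite as_ sb.
have [bd|db] := ltP b (sup S + d); first exact: (loc s b).
have Pc : P (sup S + d / 2) by apply: (loc s) => //; lra.
have : sup S + d / 2 <= sup S.
  by apply: ub_le_sup => //; split=> //; apply/andP; split; lra.
lra.
Qed.

(** The interval [s, y] has to contain t: differentiability at t alone controls
    increments over [s, t] and over [t, y], hence over their union, but not over
    a nearby interval that avoids t. *)
Lemma derive_le0_straddle (R : realType) (F : R -> R) (t d e : R) :
  is_derive t 1 F d -> d <= 0 -> 0 < e ->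
  exists2 r, 0 < r & forall s y, s <= t -> t <= y -> t - r < s -> y < t + r ->
    F y - F s <= e * (y - s).
Proof.
move=> [/cvg_ex[l lE]]; rewrite /derive (cvg_lim _ lE)// => ld d0 e0.
move: d0; rewrite -ld => d0.
move/cvgrPdist_lt : lE => /(_ e e0) /= /nbhs_ballP[r /= r0 rE].
exists r => // s y st ty rs yr.
have quot h : `|h| < r -> h != 0 -> h^-1 * (F (h + t) - F t) < e.
  move=> hr h0; have := rE h; rewrite /ball/= sub0r normrN => /(_ hr h0).
  rewrite -[_%:A]/(h * 1) mulr1 -[_ *: _]/(h^-1 * _) ltr_norml.
  by move=> /andP[H _]; move: H d0; lra.
have right : F y - F t <= e * (y - t).
  have [->|yt] := eqVneq y t; first by rewrite !subrr mulr0.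
  have yt0 : 0 < y - t by rewrite subr_gt0 lt_neqAle eq_sym yt.
  have := quot (y - t); rewrite subrK gtr0_norm// => /(_ _ (lt0r_neq0 yt0)).
  by rewrite ltr_pdivrMl// mulrC => H; apply/ltW/H; lra.
have left : F t - F s <= e * (t - s).
  have [->|ts] := eqVneq s t; first by rewrite !subrr mulr0.
  have ts0 : s - t < 0 by rewrite subr_lt0 lt_neqAle ts.
  have := quot (s - t); rewrite subrK ltr0_norm// => /(_ _ (ltr0_neq0 ts0)).
  rewrite ltr_ndivrMl// => H.
  have {H} : (s - t) * e < F s - F t by apply: H; lra.
  nra.
nra.
Qed.

Lemma disjoint_itv_length_le (R : realType) (k : nat) (l r : 'I_k -> R)
    (U : set R) :
  measurable U -> (forall i, l i <= r i) ->
  (forall i, `]l i, r i[%classic `<=` U) ->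
  trivIset [set: 'I_k] (fun i => `]l i, r i[%classic) ->
  ((\sum_(i < k) (r i - l i))%:E <= lebesgue_measure U)%E.
Proof.
move=> mU lr lrU tI.
have -> : ((\sum_(i < k) (r i - l i))%:E =
    lebesgue_measure (\big[setU/set0]_(i < k) `]l i, r i[%classic))%E.
  rewrite measure_bigsetU_ord//.
  rewrite -sumEFin; apply: eq_bigr => i _.
  rewrite -[RHS]/(lebesgue_measure `]l i, r i[%classic).
  rewrite lebesgue_measure_itv/= lte_fin.
  case: ltP => // rl; congr EFin.
  by apply/eqP; rewrite subr_eq0 eq_le rl lr.
apply: le_measure; rewrite ?inE//.
  by apply: bigsetU_measurable.
elim/big_ind : _ => // A C AU CU x []; [exact: AU | exact: CU].
Qed.

(** Outer regularity, applied to a measurable null set containing the points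
    where P fails. *)
Lemma ae_open_superset (R : realType) (P : R -> Prop) (e : R) : 0 < e ->
  {ae @lebesgue_measure R, forall t, P t} ->
  exists U : set R, [/\ open U, (lebesgue_measure U < e%:E)%E &
                        forall t, ~ P t -> U t].
Proof.
move=> e0 [A [mA A0 PA]].
have [|U [oU AU Ue]] := lebesgue_regularity_outer mA _ e0.
  apply: le_lt_trans (ltry 0).
  by rewrite le_eqVlt; apply/orP; left; apply/eqP/A0.
exists U; split => //; last by move=> t nPt; apply/AU/PA.
have mU : measurable U := measurable_realfun.open_measurable oU.
have UE : (lebesgue_measure U =
    lebesgue_measure (U `\` A) + lebesgue_measure (U `&` A))%E.
  exact: measureDI.
have UA0 : lebesgue_measure (U `&` A) = 0%E.
  apply: (@subset_measure0 _ _ _ (@lebesgue_measure R) (U `&` A) A) => //.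
  exact: measurableI.
by rewrite UE UA0 adde0.
Qed.

(** The increment of F over [a, s] is at most e (s - a) plus its increments over
    finitely many disjoint intervals inside an open set U that is small and
    contains all points of [a, b] without a nonpositive derivative. This
    property [chain] passes from s to y whenever s and y enclose t and are close
    to it: when t is in U the interval ]s, y[ joins the family, otherwise the
    derivative at t pays for the increment. Absolute continuity then bounds the
    sum over the family by e. *)
Lemma abs_cont_ae_derive_le0 (R : realType) (a b : R) (F : R -> R) :
  a <= b -> abs_cont a b F ->
  {ae @lebesgue_measure R, forall t, a <= t <= b ->
     exists2 d, is_derive t 1 F d & d <= 0} ->
  F b <= F a.
Proof.
move=> ab acF dF.
suff approx e : 0 < e -> F b - F a <= e * (b - a) + e.
  apply/ler_addgt0Pr => e e0.
  (* The total error e' (b - a) + e' equals e for e' = e / (b - a + 1). *)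
  have c0 : 0 < b - a + 1 by rewrite ltr_wpDl// subr_ge0.
  have := approx (e / (b - a + 1)) (divr_gt0 e0 c0).
  have -> : e / (b - a + 1) * (b - a) + e / (b - a + 1) = e.
    by field; rewrite lt0r_neq0.
  by rewrite lerBlDl.
move=> e0.
have [r r0 acFr] := acF e e0.
have [U [oU Ur dU]] := ae_open_superset r0 dF.
have mU : measurable U := measurable_realfun.open_measurable oU.
pose chain s := exists (k : nat) (l u : nat -> R),
  [/\ forall i, (i < k)%N -> [/\ a <= l i, l i <= u i & u i <= s],
      forall i, (i < k)%N -> `]l i, u i[%classic `<=` U,
      trivIset `I_k (fun i => `]l i, u i[%classic) &
      F s - F a <= e * (s - a) + \sum_(i < k) (F (u i) - F (l i))].
have : chain b.
  apply: (@creeping_induction _ a b) => //.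
    exists 0%N, (fun=> a), (fun=> a); split => //.
    by rewrite big_ord0 !subrr mulr0 addr0.
  move=> t tab.
  have [Ut|nUt] := pselect (U t).
    have /nbhs_ballP[d /= d0 dU'] := open_nbhs_nbhs (conj oU Ut).
    exists d => // s y as_ st ty yb ds yd [k [l [u [lu luU tI Fs]]]].
    exists k.+1, (fun i => if (i < k)%N then l i else s),
                 (fun i => if (i < k)%N then u i else y).
    split.
    - move=> i _; case: ifPn => [ik|_]; last by split => //; exact: le_trans ty.
      have [? ? us] := lu i ik; split=> //.
      exact: le_trans us (le_trans st ty).
    - move=> i _; case: ifPn => [|_]; first exact: luU.
      move=> z /=; rewrite in_itv/= => /andP[sz zy]; apply: dU'.
      by rewrite /ball/= ltr_norml; apply/andP; split; lra.
    - apply/trivIsetP => i j; rewrite /= !ltnS => ik jk ij.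
      wlog ij' : i j ik jk ij / (i < j)%N.
        move=> H; have [|ji|E] := ltngtP i j; first exact: H.
          by rewrite setIC; apply: H => //; rewrite eq_sym.
        by rewrite E eqxx in ij.
      have ik' : (i < k)%N by exact: leq_trans jk.
      rewrite ik'; case: ifPn => [jk'|_].
        by move/trivIsetP : tI; apply.
      apply/seteqP; split => // z [] /=.
      rewrite !in_itv/= => /andP[_ zu] /andP[sz _].
      have [_ _ us] := lu i ik'.
      by have := lt_le_trans (lt_trans sz zu) us; rewrite ltxx.
    - rewrite big_ord_recr/= ltnn.
      under eq_bigr => i _ do rewrite ltn_ord.
      have : e * (s - a) <= e * (y - a).
        by rewrite ler_pM2l// lerD2r (le_trans st).
      lra.
  have [D tD D0] : exists2 D, is_derive t 1 F D & D <= 0.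
    by apply: contrapT => nD; apply: nUt; apply: dU => /(_ tab).
  have [d d0 slope] := derive_le0_straddle tD D0 e0.
  exists d => // s y as_ st ty yb ds yd [k [l [u [lu luU tI Fs]]]].
  exists k, l, u; split => //.
    move=> i ik; have [? ? us] := lu i ik; split=> //.
    exact: le_trans us (le_trans st ty).
  have := slope s y st ty ds yd.
  lra.
case=> k [l [u [lu luU tI Fb]]].
have tI' : trivIset [set: 'I_k] (fun i : 'I_k => `]l i, u i[%classic).
  move/trivIsetP : tI => tI; apply/trivIsetP => i j _ _ ij.
  by apply: tI => //=.
have len : \sum_(i < k) (u i - l i) < r.
  rewrite -lte_fin; apply: le_lt_trans Ur.
  apply: disjoint_itv_length_le => // i; last exact: luU.
  by have [] := lu i (ltn_ord i).
have := acFr k l u (fun i => lu i (ltn_ord i)) tI' len.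
have : \sum_(i < k) (F (u i) - F (l i)) <= \sum_(i < k) `|F (u i) - F (l i)|.
  by apply: ler_sum => i _; exact: ler_norm.
lra.
Qed.

(** * Closure properties of absolute continuity *)

Lemma abs_cont_cst (R : realType) (a b c : R) : abs_cont a b (fun=> c).
Proof.
move=> e e0; exists 1 => // k l r _ _ _.
by rewrite big1// => i _; rewrite subrr normr0.
Qed.

Lemma abs_cont_id (R : realType) (a b : R) : abs_cont a b (fun t : R => t).
Proof.
move=> e e0; exists e => // k l r lr _; apply: le_lt_trans.
by apply: ler_sum => i _; have [_ lri _] := lr i; rewrite ger0_norm ?subr_ge0.
Qed.

Lemma abs_contD (R : realType) (a b : R) (F G : R -> R) :
  abs_cont a b F -> abs_cont a b G -> abs_cont a b (fun t => F t + G t).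
Proof.
move=> acF acG e e0; have e20 : 0 < e / 2 by rewrite divr_gt0.
have [dF dF0 HF] := acF _ e20; have [dG dG0 HG] := acG _ e20.
exists (Num.min dF dG); first by rewrite lt_min dF0.
move=> k l r lr tI; rewrite lt_min => /andP[sF sG].
apply: le_lt_trans (_ : _ <= \sum_(i < k) (`|F (r i) - F (l i)| +
    `|G (r i) - G (l i)|)) _.
  by apply: ler_sum => i _; rewrite opprD addrACA ler_normD.
rewrite big_split/= (splitr e).
by apply: ltrD; [exact: HF | exact: HG].
Qed.

(** F varies by less than 1 over a length less than d, so advancing from a by
    steps of d / 2 bounds it by |F a| plus the number of steps. *)
Lemma abs_cont_bounded (R : realType) (a b : R) (F : R -> R) :
  abs_cont a b F -> exists2 C, 0 < C & forall t, a <= t <= b -> `|F t| <= C.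
Proof.
move=> acF; have [d d0 Fd] := acF 1 ltr01.
have step s t : a <= s -> s <= t -> t <= b -> t - s < d -> `|F t| < `|F s| + 1.
  move=> as_ st tb tsd.
  have : `|F t - F s| < 1.
    have := Fd 1%N (fun=> s) (fun=> t); rewrite !big_ord1; apply => //.
    by apply/trivIsetP => i j _ _; rewrite !ord1 eqxx.
  have := ler_normD (F t - F s) (F s); rewrite subrK; lra.
have bound (k : nat) t :
    a <= t -> t <= b -> t - a <= k%:R * (d / 2) -> `|F t| <= `|F a| + k%:R.
  elim: k t => [|k IHk] t at_ tb.
    by rewrite mul0r subr_le0 addr0 => ta; have -> : t = a by lra.
  rewrite -natr1 mulrDl mul1r => tk.
  have [ta|ta] := leP (t - d / 2) a.
    have := step a t (lexx _) at_ tb; have : 0 <= k%:R :> R by rewrite ler0n.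
    by move=> k0 H; have := H _; lra.
  have := step (t - d / 2) t; have := IHk (t - d / 2).
  move=> /(_ (ltW ta)) H1 H2.
  by have := H1 _ _; have := H2 _ _ _ _; lra.
pose N := Num.Def.truncn ((b - a) / (d / 2)).
exists (`|F a| + N.+1%:R) => [|t /andP[at_ tb]].
  by rewrite ltr_wpDl.
apply: bound => //; have d20 : 0 < d / 2 by rewrite divr_gt0.
rewrite -ler_pdivrMr//; apply: ltW; apply: le_lt_trans (truncnS_gt _).
by rewrite ler_pM2r ?invr_gt0// lerD2r.
Qed.

Lemma abs_contM (R : realType) (a b : R) (F G : R -> R) :
  abs_cont a b F -> abs_cont a b G -> abs_cont a b (fun t => F t * G t).
Proof.
move=> acF acG e e0.
have [C C0 FC] := abs_cont_bounded acF; have [D D0 GD] := abs_cont_bounded acG.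
have eD0 : 0 < e / 2 / D by rewrite !divr_gt0.
have eC0 : 0 < e / 2 / C by rewrite !divr_gt0.
have [dF dF0 HF] := acF _ eD0; have [dG dG0 HG] := acG _ eC0.
exists (Num.min dF dG); first by rewrite lt_min dF0.
move=> k l r lr tI; rewrite lt_min => /andP[sF sG].
apply: le_lt_trans (_ : _ <= \sum_(i < k) (D * `|F (r i) - F (l i)| +
    C * `|G (r i) - G (l i)|)) _.
  apply: ler_sum => i _; have [al lri rb] := lr i.
  have -> : F (r i) * G (r i) - F (l i) * G (l i) =
      G (r i) * (F (r i) - F (l i)) + F (l i) * (G (r i) - G (l i)) by ring.
  apply: le_trans (ler_normD _ _) _; rewrite !normrM.
  by apply: lerD; apply: ler_wpM2r => //; [apply: GD | apply: FC]; apply/andP;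
     split=> //; [exact: le_trans lri | exact: le_trans rb].
rewrite big_split/= -!mulr_sumr (splitr e).
apply: ltrD.
  by rewrite mulrC -ltr_pdivlMr//; exact: HF.
by rewrite mulrC -ltr_pdivlMr//; exact: HG.
Qed.

(** The norm on vectors is the maximum of the coordinates. *)
Lemma abs_cont_coord (R : realType) (n : nat) (a b : R) (x : R -> 'cV[R]_n) i :
  abs_cont a b x -> abs_cont a b (fun t => x t i 0).
Proof.
move=> acx e e0; have [d d0 xd] := acx e e0; exists d => // k l r lr tI sd.
apply: le_lt_trans (xd k l r lr tI sd); apply: ler_sum => j _.
have -> : x (r j) i 0 - x (l j) i 0 = (x (r j) - x (l j)) i 0 by rewrite !mxE.
rewrite [leRHS]/Num.Def.normr/= mx_normrE.
exact: (le_bigmax _ (fun ij => `|(x (r j) - x (l j)) ij.1 ij.2|) (i, 0)).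
Qed.

(** * Polynomials along a curve *)

(** Absolute continuity and the chain rule are preserved by sums and products,
    which this principle matches better than the expansion in monomials. *)
Lemma mpoly_ring_ind (R : nzRingType) (N : nat) (P : mpoly N R -> Prop) :
  (forall c, P (mpolyC N c)) -> (forall i, P (mpolyX R (mnm1 i))) ->
  (forall p q, P p -> P q -> P (p + q)) ->
  (forall p q, P p -> P q -> P (p * q)) ->
  forall p, P p.
Proof.
move=> PC PX PD PM p; rewrite (mpolyE p).
elim/big_ind : _ => [||m _].
- by rewrite -(mpolyC0 N); exact: PC.
- exact: PD.
- rewrite -mul_mpolyC; apply: (PM _ _ (PC _)).
  rewrite mpolyXE_id; elim/big_ind : _ => [||i _].
  - by rewrite -(mpolyC1 N); exact: PC.
  - exact: PM.
  - elim: (m i) => [|k IHk]; first by rewrite expr0 -(mpolyC1 N); exact: PC.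
    by rewrite exprS; exact: PM.
Qed.

Lemma abs_cont_meval (R : realType) (N : nat) (a b : R) (z : R -> 'I_N -> R)
    (p : mpoly N R) :
  (forall k, abs_cont a b (fun t => z t k)) ->
  abs_cont a b (fun t => meval (z t) p).
Proof.
move=> acz; elim/mpoly_ring_ind : p => [c|i|p q IHp IHq|p q IHp IHq].
- have -> : (fun s => meval (z s) (mpolyC N c)) = (fun s => c)
    by apply/funext => s; exact: mevalC.
  exact: abs_cont_cst.
- have -> : (fun s => meval (z s) (mpolyX R (mnm1 i))) = (fun s => z s i)
    by apply/funext => s; exact: mevalXU.
  exact: acz.
- have -> : (fun s => meval (z s) (p + q)) =
      (fun s => meval (z s) p + meval (z s) q)
    by apply/funext => s; exact: mevalD.
  exact: abs_contD.
- have -> : (fun s => meval (z s) (p * q)) =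
      (fun s => meval (z s) p * meval (z s) q)
    by apply/funext => s; exact: mevalM.
  exact: abs_contM.
Qed.

(** The chain rule for polynomials; for a product p q it is Leibniz' rule, both
    for the curve and for the formal partial derivatives. *)
Lemma is_derive_meval (R : realType) (N : nat) (z : R -> 'I_N -> R)
    (dz : 'I_N -> R) (t : R) (p : mpoly N R) :
  (forall k, is_derive t 1 (fun s => z s k) (dz k)) ->
  is_derive t 1 (fun s => meval (z s) p)
    (\sum_(k < N) meval (z t) (mderiv k p) * dz k).
Proof.
move=> zdz; elim/mpoly_ring_ind : p => [c|i|p q IHp IHq|p q IHp IHq].
- have -> : (fun s => meval (z s) (mpolyC N c)) = (fun s => c)
    by apply/funext => s; exact: mevalC.
  rewrite big1 => [|k _]; first exact: is_derive_cst.
  by rewrite mderivC meval0 mul0r.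
- have -> : (fun s => meval (z s) (mpolyX R (mnm1 i))) = (fun s => z s i)
    by apply/funext => s; exact: mevalXU.
  rewrite (bigD1 i)//= big1 => [|k ki].
    rewrite mderivX mevalZ mnm1E eqxx mul1r mevalX big1 ?mul1r ?addr0// => j _.
    by rewrite mnmBE subnn expr0.
  by rewrite mderivX mnm1E eq_sym (negPf ki) scale0r meval0 mul0r.
- have -> : (fun s => meval (z s) (p + q)) =
      (fun s => meval (z s) p + meval (z s) q)
    by apply/funext => s; exact: mevalD.
  apply: is_derive_eq (is_deriveD _ _) _.
  rewrite -big_split/=; apply: eq_bigr => k _.
  by rewrite mderivD mevalD mulrDl.
- have -> : (fun s => meval (z s) (p * q)) =
      (fun s => meval (z s) p * meval (z s) q)
    by apply/funext => s; exact: mevalM.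
  apply: is_derive_eq (is_deriveM _ _) _.
  rewrite -[LHS]/(_ * _ + _ * _) !mulr_sumr -big_split/=; apply: eq_bigr => k _.
  rewrite mderivM mevalD !mevalM; ring.
Qed.

Lemma is_derive_coord (R : realType) (n : nat) (x : R -> 'cV[R]_n)
    (v : 'cV[R]_n) (t : R) i :
  is_derive t 1 x v -> is_derive t 1 (fun s => x s i 0) (v i 0).
Proof.
move=> [dx <-]; split; first exact: (derivable_mxP _ _ _).1.
by rewrite derive_mx// mxE.
Qed.

Lemma is_derive_eval_xt (R : realType) (n : nat) (p : mpoly (n + 1)%N R)
    (x : R -> 'cV[R]_n) (v : 'cV[R]_n) (t : R) :
  is_derive t 1 x v ->
  is_derive t 1 (fun s => eval_xt p (x s) s)
    (eval_xt (dt p) (x t) t + ((grad_at p (x t) t)^T *m v) 0 0).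
Proof.
move=> xv.
pose dz (k : 'I_(n + 1)) := if fintype.split k is inl i then v i 0 else 1.
have zdz k : is_derive t 1 (fun s => col_mx (x s) s%:M k 0) (dz k).
  rewrite /dz; under eq_fun do rewrite mxE.
  case: (fintype.split k) => j; first exact: is_derive_coord.
  under eq_fun do rewrite (ord1 j) mxE eqxx.
  exact: is_derive_id.
apply: is_derive_eq (is_derive_meval p zdz) _.
rewrite big_split_ord/= big_ord1 addrC; congr (_ + _).
  by rewrite /dz -[rshift n 0]/(unsplit (inr _ 0)) unsplitK mulr1.
rewrite mxE; apply: eq_bigr => i _.
by rewrite /dz -[lshift 1 i]/(unsplit (inl _ i)) unsplitK !mxE.
Qed.

(** * Evaluation of the certificates *)

Lemma sos_ge0 (A : pzRingType) (R : realDomainType) (phi : {rmorphism A -> R})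
  (p : A) : sos p -> 0 <= phi p.
Proof.
move=> [s ->]; rewrite rmorph_sum/=; apply: sumr_ge0 => q _.
by rewrite rmorphXn/= sqr_ge0.
Qed.

Lemma eval_of_t (R : realType) (n : nat) (p : {poly R}) (x : 'cV[R]_n) (t : R) :
  eval_xt (of_t n p) x t = p.[t].
Proof.
rewrite /eval_xt /of_t -horner_map/= -map_poly_comp.
rewrite (eq_map_poly (g := id)) ?map_poly_id// => [|c]; last exact: mevalC.
by rewrite mevalXU col_mxEd mxE eqxx.
Qed.

Lemma eval_at_time (R : realType) (n : nat) (p : mpoly (n + 1)%N R)
    (x : 'cV[R]_n) (s : R) :
  eval_x (at_time s p) x = eval_xt p x s.
Proof.
rewrite /eval_x /at_time /eval_xt comp_mpoly_meval; apply: meval_eq => k.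
rewrite tnth_mktuple mxE; case: (fintype.split k) => j; first exact: mevalXU.
by rewrite [LHS]mevalC (ord1 j) mxE eqxx.
Qed.

(** The segment [p, q] is a convex set containing p and q, hence it contains
    the smallest such set. *)
Lemma co_pair (R : realType) (V : lmodType R) (p q v : V) :
  co [set p; q] v -> exists2 r : R, 0 <= r <= 1 & v = r *: p + (1 - r) *: q.
Proof.
pose S := [set w | exists2 r : R, 0 <= r <= 1 & w = r *: p + (1 - r) *: q].
move=> /(_ S); apply; split => [|w [->|->]]; last 2 first.
- by exists 1; rewrite ?ler01 ?lexx// subrr scale1r scale0r addr0.
- by exists 0; rewrite ?ler01 ?lexx// subr0 scale1r scale0r add0r.
move=> w1 w2 t; rewrite !inE => -[r1 /andP[r10 r11] ->] [r2 /andP[r20 r21] ->].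
have t0 : (0 : R) <= t%:num by [].
have t1 : t%:num <= (1 : R) by [].
exists (t%:num * r1 + (1 - t%:num) * r2); first by nra.
rewrite -[LHS]/(t%:num *: (r1 *: p + (1 - r1) *: q) +
                (1 - t%:num) *: (r2 *: p + (1 - r2) *: q)).
rewrite !scalerDr !scalerA addrACA -!scalerDl; congr (_ *: _ + _ *: _).
ring.
Qed.

Lemma eval_grad_mulmx (R : realType) (n k : nat) (p : mpoly (n + 1)%N R)
    (A : 'M[mpoly (n + 1)%N R]_(n, k)) (x : 'cV[R]_n) (t : R) i j :
  eval_xt (((grad p)^T *m A) i j) x t =
  ((grad_at p x t)^T *m map_mx (fun q => eval_xt q x t) A) i j.
Proof.
rewrite !mxE /eval_xt rmorph_sum/=; apply: eq_bigr => l _.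
by rewrite mevalM !mxE.
Qed.

(** The inverse in the formula of the controller cancels the factor
    (dB/dx)^T g g^T dB/dx. *)
Lemma grad_mul_control (R : realType) (n m : nat) (g : R -> 'M[R]_(n, m))
    (B W : mpoly (n + 1)%N R) (x : 'cV[R]_n) (t : R) :
  control_denom g B x t \in unitmx ->
  ((grad_at B x t)^T *m (g t *m control g B W x t)) 0 0 = eval_xt W x t.
Proof.
move=> dU; rewrite /control !mulmxA.
rewrite -[X in X *m invmx _]/(control_denom g B x t).
by rewrite mulmxV// mul1mx mxE eqxx.
Qed.

(** The multiplier m0 is subtracted times (t - tN) (T - t), which is nonnegative
    on [tN, T]: there the inequality survives without that term.
    A is the polynomial vector field, f - M sigma or f + M sigma. *)
Lemma sos_decrease_condition (R : realType) (n : nat)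
    (B W m0 : mpoly (n + 1)%N R) (A : 'cV[mpoly (n + 1)%N R]_n)
    (tN T : R) (x : 'cV[R]_n) (t : R) :
  tN <= t <= T -> sos m0 ->
  sos (- dt B - ((grad B)^T *m A) 0 0
       - W - m0 * (tvar R n - cst_xt n tN) * (cst_xt n T - tvar R n)) ->
  eval_xt (dt B) x t +
    ((grad_at B x t)^T *m map_mx (fun p => eval_xt p x t) A) 0 0
    + eval_xt W x t <= 0.
Proof.
move=> /andP[tNt tT] hm0 hS.
pose ev : {rmorphism mpoly (n + 1)%N R -> R} :=
  meval (fun k => col_mx x t%:M k 0).
have := sos_ge0 ev hS; have := sos_ge0 ev hm0.
rewrite !(rmorphB, rmorphN, rmorphM)/=.
rewrite -![meval _ _]/(eval_xt _ x t) eval_grad_mulmx.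
have -> : eval_xt (tvar R n) x t = t.
  by rewrite /eval_xt mevalXU col_mxEd mxE eqxx.
have cstE c : eval_xt (cst_xt n c) x t = c by exact: mevalC.
rewrite !cstE => m0_ge0.
have : 0 <= eval_xt m0 x t * (t - tN) * (T - t).
  by rewrite !mulr_ge0// subr_ge0.
lra.
Qed.

(** The easy half of a Positivstellensatz certificate. *)
Lemma sos_certificate_ge0 (R : realType) (n nc : nat) (l s : 'I_nc -> mpoly n R)
    (p : mpoly n R) (x : 'cV[R]_n) :
  (forall i, sos (s i)) -> sos (p + \sum_(i < nc) s i * l i) ->
  unsafe_set l x -> 0 <= eval_x p x.
Proof.
move=> hs hp xu.
pose ev : {rmorphism mpoly n R -> R} := meval (fun k => x k 0).
have := sos_ge0 ev hp; rewrite rmorphD rmorph_sum/= => /le_trans; apply.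
rewrite gerDl; apply: sumr_le0 => i _; rewrite mevalM.
by apply: mulr_ge0_le0; [exact: (sos_ge0 ev (hs i)) | exact: xu].
Qed.

Theorem lemma2 (R : realType) (n m nc : nat) (tN T : R) (hT : tN < T)
  (xN : 'cV[R]_n)
  (* data-driven model: the entries of f and g are the polynomials fP and gP
     on [tN, T] *)
  (f : R -> 'cV[R]_n) (g : R -> 'M[R]_(n, m))
  (fP : 'cV[{poly R}]_n) (gP : 'M[{poly R}]_(n, m))
  (hf : forall t : R, tN <= t <= T -> f t = map_mx (fun p => p.[t]) fP)
  (hg : forall t : R, tN <= t <= T -> g t = map_mx (fun p => p.[t]) gP)
  (M : R) (hM : 0 < M) (sigma : {poly R}) (hsigma : sos sigma)
  (l : 'I_nc -> mpoly n R)
  (B W m1 m2 : mpoly (n + 1)%N R)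
  (s : 'I_nc -> mpoly n R)
  (q1 : 'cV[mpoly (n + 1)%N R]_m) (q2 : mpoly (n + 1)%N R)
  (c : R)
  (hW : sos W) (hm1 : sos m1) (hm2 : sos m2) (hs : forall i, sos (s i))
  (hq2 : sos q2) (hc : 0 < c)
  (hB1 : sos (at_time T B - cst_x n (eval_xt B xN tN)
              + \sum_(i < nc) s i * l i - cst_x n c))
  (hB2 : sos (- dt B
              - ((grad B)^T *m (map_mx (@of_t R n) fP
                                - const_mx (of_t n (M *: sigma)))) 0 0
              - W - m1 * (tvar R n - cst_xt n tN) * (cst_xt n T - tvar R n)))
  (hB3 : sos (- dt B
              - ((grad B)^T *m (map_mx (@of_t R n) fP
                                + const_mx (of_t n (M *: sigma)))) 0 0
              - W - m2 * (tvar R n - cst_xt n tN) * (cst_xt n T - tvar R n)))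
  (hB4 : sos (- (((grad B)^T *m map_mx (@of_t R n) gP) *m q1) 0 0 - q2))
  (x : R -> 'cV[R]_n)
  (hx : is_solution f g M sigma B W tN T xN x) :
  ~ unsafe_set l (x T).
Proof.
move=> xTu; have [acx xN0 dyn] := hx.
have decr : eval_xt B (x T) T <= eval_xt B (x tN) tN.
  apply: (@abs_cont_ae_derive_le0 _ tN T (fun t => eval_xt B (x t) t)).
  - exact: ltW.
  - apply: abs_cont_meval => k; rewrite -(splitK k).
    case: (fintype.split k) => j /=.
      under [X in abs_cont _ _ X]funext do rewrite col_mxEu.
      exact: abs_cont_coord.
    under [X in abs_cont _ _ X]funext do rewrite (ord1 j) col_mxEd mxE eqxx.
    exact: abs_cont_id.
  move: dyn; apply: filterS.
    exact: (ae_filter_ringOfSetsType lebesgue_measure).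
  move=> t dyn tI.
  have [dU [v xv /co_pair[r /andP[r0 r1] vE]]] := dyn tI.
  eexists; first exact: is_derive_eval_xt xv.
  have evf : map_mx (fun p => eval_xt p (x t) t) (map_mx (@of_t R n) fP) = f t.
    by rewrite hf//; apply/matrixP => i j; rewrite !mxE eval_of_t.
  pose delta : 'cV[R]_n := const_mx (M * sigma.[t]).
  have evm : map_mx (fun p => eval_xt p (x t) t)
      (map_mx (@of_t R n) fP - const_mx (of_t n (M *: sigma))) = f t - delta.
    rewrite -evf; apply/matrixP => i j; rewrite !mxE -hornerZ.
    rewrite -(eval_of_t _ (x t)).
    exact: mevalB.
  have evp : map_mx (fun p => eval_xt p (x t) t)
      (map_mx (@of_t R n) fP + const_mx (of_t n (M *: sigma))) = f t + delta.
    rewrite -evf; apply/matrixP => i j; rewrite !mxE -hornerZ.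
    rewrite -(eval_of_t _ (x t)).
    exact: mevalD.
  have := sos_decrease_condition (x t) tI hm1 hB2.
  have := sos_decrease_condition (x t) tI hm2 hB3.
  rewrite evm evp.
  have := grad_mul_control W dU.
  rewrite vE /Xdot_minus /Xdot_plus -/delta.
  set u := g t *m _.
  pose dot (w : 'cV[R]_n) := ((grad_at B (x t) t)^T *m w) 0 0.
  have dotD w1 w2 : dot (w1 + w2) = dot w1 + dot w2 by rewrite /dot mulmxDr mxE.
  have dotN w : dot (- w) = - dot w by rewrite /dot mulmxN mxE.
  have dotZ k w : dot (k *: w) = k * dot w by rewrite /dot -scalemxAr mxE.
  rewrite -![(_ *m _) 0 0]/(dot _) !(dotD, dotN, dotZ).
  (* The derivative is the combination, with weights r and 1 - r, of its two
     nonpositive extreme values. *)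
  nra.
have hB1' : sos ((at_time T B - cst_x n (eval_xt B xN tN) - cst_x n c)
              + \sum_(i < nc) s i * l i) by rewrite addrAC.
have := sos_certificate_ge0 hs hB1' xTu.
rewrite /eval_x !mevalB !mevalC -[X in X - _ - _]/(eval_x _ _) eval_at_time.
move: decr; rewrite xN0; lra.
Qed.
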